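(* Let $n\ge 2$ and let $\pi,\sigma\in\mathfrak{B}_n$ be selected independently and uniformly at random. Let $p_{n,2}=\mathbb{P}(\pi\text{ and }\sigma\text{ are comparable})$ and $p_{n,2,\le}=\mathbb{P}(\pi\le\sigma)$, with respect to Bruhat order. Then $$p_{n,2}=\frac{\mathfrak{b}_{n+2}-5}{5\,\mathfrak{b}_n}\qquad\text{and}\qquad p_{n,2,\le}=\frac{\mathfrak{b}_{n+2}}{10\,\mathfrak{b}_n}.$$
   Context: $\mathfrak{S}_n$ is the set of permutations of $[n]=\{1,\dots,n\}$, in one-line notation. A reduction of $\omega\in\mathfrak{S}_n$ interchanges $\omega(i)$ and $\omega(j)$ for some $i<j$ with $\omega(i)>\omega(j)$. Bruhat order: $\pi\le\sigma$ if $\pi$ is obtained from $\sigma$ by a (possibly empty) sequence of reductions. $\mathfrak{B}_n\subseteq\mathfrak{S}_n$ is the set of bigrassmannian permutations, i.e. those $\omega$ such that both $\omega$ and $\omega^{-1}$ have exactly one descent; equivalently $\omega=1\cdots a\,(b+1)\cdots c\,(a+1)\cdots b\,(c+1)\cdots n$ for some $0\le a<b<c\le n$. $\mathfrak{b}_n=|\mathfrak{B}_n|=\binom{n+1}{3}$. $\pi,\sigma$ are comparable if $\pi\le\sigma$ or $\sigma\le\pi$. *)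

(* Defs.v *)
From mathcomp Require Import all_boot all_order all_fingroup all_algebra.

Set Implicit Arguments.
Unset Strict Implicit.
Unset Printing Implicit Defensive.

Import GroupScope.

(* The set [n] is represented by 'I_n = {0, ..., n-1}, i.e. positions and
   values are shifted down by one. *)

(* i is a descent when i + 1 is still a position and w(i) > w(i + 1). *)
Definition descents (n : nat) (w : 'S_n) : {set 'I_n} :=
  [set i : 'I_n | [exists j : 'I_n, (j == i.+1 :> nat) && (w j < w i)%N]].

(* Since (s * t) x = t (s x) in 'S_n, [tperm i j * w] is w with the entries
   in positions i and j of its one-line notation interchanged. *)
Definition reduction (n : nat) (w w' : 'S_n) : bool :=
  [exists i : 'I_n, exists j : 'I_n,
     [&& (i < j)%N, (w j < w i)%N & w' == tperm i j * w]].

Definition bruhat_le (n : nat) (p s : 'S_n) : bool :=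
  connect (@reduction n) s p.

Definition bruhat_comparable (n : nat) (p s : 'S_n) : bool :=
  bruhat_le p s || bruhat_le s p.

Definition bigrassmannian (n : nat) (w : 'S_n) : bool :=
  (#|descents w| == 1%N) && (#|descents (w^-1)| == 1%N).

Definition bigrass (n : nat) : {set 'S_n} := [set w | bigrassmannian w].

Definition nb_bigrass (n : nat) : nat := #|bigrass n|.

Local Open Scope ring_scope.

Definition uniform (T : finType) (A : {set T}) (x : T) : rat :=
  if x \in A then #|A|%:R^-1 else 0.

(* Probability of E(x, y) when x and y are drawn independently and uniformly
   from A, i.e. under the product of two copies of [uniform A]. *)
Definition prob_pair (T : finType) (A : {set T}) (E : rel T) : rat :=
  \sum_(x : T) \sum_(y : T | E x y) uniform A x * uniform A y.

Definition p_comparable (n : nat) : rat :=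
  prob_pair (bigrass n) (@bruhat_comparable n).

Definition p_le (n : nat) : rat := prob_pair (bigrass n) (@bruhat_le n).

(* Main.v *)
(* In 0-indexed notation, a bigrassmannian permutation exchanges two adjacent
   blocks of lengths s, t >= 1 starting at position a.  Let rank w p b be the
   number of positions k < p with b <= w k; reductions never increase it.
   The exchange w of (a, s, t) is the least permutation in Bruhat order with
   rank w (a + s) (a + t) >= s, whence
     (a, s, t) <= (a', s', t')  iff
     a' <= a, s <= s', t <= t' and a + s + t <= a' + s' + t'.
   Below (a', s', t') there are then s' t' (s' + t') / 2 bigrassmannians, and
   summing this over all (a', s', t') gives b_n b_(n+2) / 10 pairs. *)
Require Import Defs.
From mathcomp Require Import all_boot all_order all_fingroup all_algebra.
From mathcomp Require Import zify ring.

Set Implicit Arguments.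
Unset Strict Implicit.
Unset Printing Implicit Defensive.

(** * Exchanges of two adjacent blocks *)

Definition blockswap (a s t i : nat) : nat :=
  if i < a then i else if i < a + s then i + t
  else if i < a + s + t then i - s else i.

Lemma blockswapK a s t : cancel (blockswap a s t) (blockswap a t s).
Proof. by move=> i; rewrite /blockswap; do !case: ifP; lia. Qed.

Lemma blockswap_lt n a s t i :
  a + s + t <= n -> i < n -> blockswap a s t i < n.
Proof. by rewrite /blockswap; do !case: ifP; lia. Qed.

(** Found by search, so that no proof of [a + s + t <= n] enters the term; the default identity is
    never met within that range. *)
Definition blockperm (n a s t : nat) : 'S_n :=
  odflt 1%g [pick w : 'S_n | [forall i, w i == blockswap a s t i :> nat]].

Lemma blockpermE n a s t (i : 'I_n) :
  a + s + t <= n -> blockperm n a s t i = blockswap a s t i :> nat.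
Proof.
move=> le_n; rewrite /blockperm; case: pickP => [w /forallP/(_ i)/eqP //|].
pose g (i : 'I_n) := Ordinal (blockswap_lt le_n (ltn_ord i)).
have g_inj : injective g.
  by move=> x y [] /(can_inj (@blockswapK a s t)) /val_inj.
by move/(_ (perm g_inj))/forallP; case=> x; rewrite permE.
Qed.

Lemma eq_blockperm n a s t (w : 'S_n) : a + s + t <= n ->
  (forall i, w i = blockswap a s t i :> nat) -> w = blockperm n a s t.
Proof.
by move=> le_n wE; apply/permP => i; apply/val_inj; rewrite /= wE blockpermE.
Qed.

Lemma blockpermV n a s t : a + s + t <= n ->
  (blockperm n a s t)^-1%g = blockperm n a t s.
Proof.
move=> le_n; have le_n' : a + t + s <= n by lia.
apply: eq_blockperm => // i.
rewrite -{2}(permKV (blockperm n a s t) i) [in RHS]blockpermE //.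
by rewrite blockswapK.
Qed.

(** * Effect of a reduction on rank and weight *)

Definition rank n (w : 'S_n) (p b : nat) : nat :=
  \sum_(k < n) ((k < p) && (b <= w k)).

(** Only the terms at [i] and [j] change; old and new ones stand on opposite sides to avoid
    truncated subtraction. *)
Lemma rank_swap n (w : 'S_n) (p b : nat) (i j : 'I_n) : i != j ->
  rank (tperm i j * w)%g p b + ((i < p) && (b <= w i)) + ((j < p) && (b <= w j)) =
  rank w p b + ((j < p) && (b <= w i)) + ((i < p) && (b <= w j)).
Proof.
move=> neq_ij; have neq_ji : j != i by rewrite eq_sym.
rewrite /rank (reindex_inj (@perm_inj _ (tperm i j))) /=.
rewrite (bigD1 i) //= (bigD1 j) //= [in RHS](bigD1 i) //= [in RHS](bigD1 j) //=.
rewrite !permM !tpermK tpermL tpermR.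
set S := \sum_(_ < _ | _) _; set S' := \sum_(_ < _ | _) _.
suff -> : S = S' by lia.
apply: eq_bigr => k /andP[ki kj].
by rewrite permM tpermK tpermD // eq_sym.
Qed.

Lemma reductionP n (w w' : 'S_n) :
  reflect (exists i j : 'I_n, [/\ i < j, w j < w i & w' = (tperm i j * w)%g])
          (reduction w w').
Proof.
apply: (iffP existsP) => [[i /existsP[j /and3P[? ? /eqP ?]]]|[i [j [ij wji ->]]]].
  by exists i, j.
by exists i; apply/existsP; exists j; rewrite ij wji eqxx.
Qed.

(** The rank drops only if [i < p <= j] and [w j < b <= w i], and then by exactly one. *)
Lemma rank_reduction n (w w' : 'S_n) p b :
  reduction w w' -> rank w' p b <= rank w p b <= (rank w' p b).+1.
Proof.
case/reductionP => i [j [ij wji ->]].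
have neq_ij : i != j by rewrite neq_ltn ij.
by have := rank_swap w p b neq_ij; lia.
Qed.

Lemma rank_bruhat n (w w' : 'S_n) p b :
  bruhat_le w' w -> rank w' p b <= rank w p b.
Proof.
case/connectP => q; elim: q w => [w _ -> //|x q IH w /= /andP[wx xq] e].
by apply: leq_trans (IH _ xq e) _; case/andP: (rank_reduction p b wx).
Qed.

Definition weight n (w : 'S_n) : nat := \sum_(k < n) k * w k.

(** Rearrangement: the gain is [(j - i) * (w i - w j)]. Hence an element of maximal weight in a set
    has no reduction inside that set. *)
Lemma weight_reduction n (w w' : 'S_n) : reduction w w' -> weight w < weight w'.
Proof.
case/reductionP => i [j [ij wji ->]].
have neq_ij : i != j by rewrite neq_ltn ij.
have neq_ji : j != i by rewrite eq_sym.
rewrite /weight (bigD1 i) //= (bigD1 j) //= [in X in _ < X](bigD1 i) //=.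
rewrite [in X in _ < X](bigD1 j) //= !permM tpermL tpermR.
set S := \sum_(_ < _ | _) _; set S' := \sum_(_ < _ | _) _.
have -> : S' = S.
  by apply: eq_bigr => k /andP[ki kj]; rewrite permM tpermD // eq_sym.
by move: (nat_of_ord (w i)) (nat_of_ord (w j)) wji ij => x y; nia.
Qed.

(** * Permutations increasing on two runs of positions *)

Lemma count_lt n v : \sum_(k < n) (k < v) = minn n v.
Proof.
elim: n => [|n IH]; first by rewrite big_ord0 min0n.
by rewrite big_ord_recr /= IH; lia.
Qed.

Lemma count_perm_lt n (w : 'S_n) v : v <= n -> \sum_(k < n) (w k < v) = v.
Proof.
move=> le_vn; rewrite -[RHS](minn_idPr le_vn) -count_lt.
by rewrite [RHS](reindex_inj (@perm_inj _ w)).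
Qed.

(** Grassmannian shape: the only possible descent is from position [p - 1] to [p]. *)
Definition two_runs n (w : 'S_n) (p : nat) : Prop :=
  forall i j : 'I_n, i < j -> (j < p) || (p <= i) -> w i < w j.

Lemma two_runs_adjacent n (w : 'S_n) p :
  (forall i j : 'I_n, j = i.+1 :> nat -> i.+1 != p -> w i < w j) ->
  two_runs w p.
Proof.
move=> adj i j; have [m le_m] := ubnP (j - i); elim: m => // m IH in i le_m *.
move=> ij ijp; have lt_n : i.+1 < n by apply: leq_ltn_trans (ltn_ord j).
pose k := Ordinal lt_n; have ik : w i < w k by apply: adj => //; lia.
have [kj|jk] := ltnP k j.
  by apply: ltn_trans ik _; apply: IH => //=; simpl in *; lia.
by have -> : j = k by apply/val_inj => /=; simpl in *; lia.
Qed.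

Lemma count_two_intervals n i a p e : a <= p ->
  \sum_(k < n) ((k < i) && ((k < a) || (p <= k < e))) =
  minn (minn n i) a + (minn (minn n i) e - p).
Proof.
move=> le_ap; elim: n => [|n IH]; first by rewrite big_ord0; lia.
by rewrite big_ord_recr /= IH; lia.
Qed.

Lemma initial_segment (P : pred nat) q r : q <= r ->
  (forall i j, q <= i -> i <= j -> j < r -> P j -> P i) ->
  exists2 e, q <= e <= r & forall i, q <= i < r -> P i = (i < e).
Proof.
move=> le_qr; elim: r le_qr => [|r IH] le_qr closedP.
  by exists 0 => [|i]; lia.
have [lt_rq|le_qr'] := ltnP r q; first by exists q => [|i]; lia.
have [|e eqr Pe] := IH le_qr'.
  by move=> i j qi ij jr; apply: closedP => //; apply: ltnW.
have [Pr|nPr] := boolP (P r).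
  exists r.+1 => [|i /andP[qi ir]]; first by lia.
  by rewrite ir; apply: (closedP i r) => //; lia.
exists e => [|i /andP[qi]]; first by lia.
rewrite ltnS leq_eqVlt => /orP[/eqP ->|ir]; last by apply: Pe; lia.
by rewrite (negbTE nPr); lia.
Qed.

(** Along each run the values increase, so those below [b] fill an initial segment of that run. *)
Lemma two_runs_lt_segments n (w : 'S_n) p b : p <= n -> two_runs w p ->
  exists a e, [/\ a <= p, p <= e <= n &
    forall i : 'I_n, (w i < b) = (i < a) || (p <= i < e)].
Proof.
move=> le_pn runs; pose P k := if insub k is Some i then w i < b else true.
have PE (i : 'I_n) : P i = (w i < b) by rewrite /P valK.
have closedP q r : r <= n -> (r <= p) || (p <= q) ->
    forall i j, q <= i -> i <= j -> j < r -> P j -> P i.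
  move=> le_rn qr i j qi; rewrite leq_eqVlt => /predU1P[-> //|ij] jr.
  have lt_jn : j < n by lia.
  have lt_in : i < n by lia.
  rewrite -[i]/(val (Ordinal lt_in)) -[j]/(val (Ordinal lt_jn)) !PE.
  by apply: ltn_trans; apply: runs => //=; lia.
have [|a ap Pa] := @initial_segment P 0 p (leq0n _); first by apply: closedP; lia.
have [|e epn Pe] := @initial_segment P p n le_pn; first by apply: closedP; lia.
exists a, e; split=> // i; rewrite -PE.
have [ip|pi] := ltnP i p; first by rewrite Pa //; lia.
by rewrite Pe ?pi ?ltn_ord //; lia.
Qed.

(** The values below [b] sit at positions [[0, a)] and [[p, e)]. As the inverse also has two runs,
    the values below [b] appear in increasing order, and so do the others. So [w i] is the number of
    earlier small values, or [b] plus the number of earlier large ones, and [p], [b] and the rank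
    determine [w]. *)
Lemma two_runs_blockperm n (w : 'S_n) p b : p <= n -> b <= n ->
  two_runs w p -> two_runs w^-1%g b ->
  let s := rank w p b in
  [/\ s <= p, p - s <= b, b + s <= n & w = blockperm n (p - s) s (b - (p - s))].
Proof.
move=> le_pn le_bn runs runsV; set s := rank w p b => /=.
have [a [e [le_ap /andP[le_pe le_en] segE]]] := two_runs_lt_segments b le_pn runs.
have countE i : \sum_(k < n) ((k < i) && (w k < b)) =
    minn (minn n i) a + (minn (minn n i) e - p).
  rewrite -(count_two_intervals _ _ _ le_ap).
  by apply: eq_bigr => k _; rewrite segE.
(* Counting all positions with a value below [b] in two ways. *)
have bE : b = a + (e - p).
  have := countE n; under eq_bigr => k _ do rewrite ltn_ord /=.
  by rewrite count_perm_lt //; lia.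
have sE : s = p - a.
  have : s + \sum_(k < n) ((k < p) && (w k < b)) = \sum_(k < n) (k < p).
    by rewrite /s /rank -big_split; apply: eq_bigr => k _ /=; lia.
  by rewrite countE count_lt; lia.
have monoV (i j : 'I_n) : w i < w j -> (w j < b) || (b <= w i) -> i < j.
  by move=> wij ij; have := runsV _ _ wij ij; rewrite !permK.
have injw (i j : 'I_n) : w i = w j :> nat -> i = j by move/val_inj/perm_inj.
have wE_lt (i : 'I_n) : w i < b -> w i = \sum_(k < n) ((k < i) && (w k < b)) :> nat.
  move=> wib; rewrite -[LHS](count_perm_lt w) 1?ltnW //; apply: eq_bigr => k _.
  case: (ltngtP (w k) (w i)) => [wki|wik|/injw ->]; last by rewrite ltnn.
    by rewrite (monoV k i) ?wib // (ltn_trans wki wib).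
  case: (ltnP (w k) b) => [wkb|]; last by rewrite andbF.
  by have := monoV i k wik; rewrite wkb => /(_ isT); lia.
have wE_ge (i : 'I_n) : b <= w i ->
    w i + \sum_(k < n) ((k < i) && (w k < b)) = b + i.
  move=> bwi; rewrite -[X in X + _](count_perm_lt w) 1?ltnW //.
  have -> : b + i = \sum_(k < n) (w k < b) + \sum_(k < n) (k < i).
    by rewrite count_perm_lt // count_lt (minn_idPr (ltnW (ltn_ord i))).
  rewrite -!big_split.
  apply: eq_bigr => k _ /=.
  case: (ltngtP (w k) (w i)) => [wki|wik|/injw ->]; last by rewrite !ltnn; lia.
    case: (ltnP (w k) b) => [|bwk]; first by lia.
    by rewrite (monoV k i) ?bwk ?orbT //; lia.
  by have := monoV i k wik; rewrite bwi orbT => /(_ isT); lia.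
split; try lia.
apply: eq_blockperm => [|i]; first by lia.
have := segE i; have := wE_lt i; have := wE_ge i; rewrite countE /blockswap.
have := ltn_ord i; move: (nat_of_ord i) (nat_of_ord (w i)) => x y.
by do !case: ifP; lia.
Qed.

(** * Ranks of block exchanges *)

Lemma count_interval n lo hi : hi <= n -> \sum_(k < n) (lo <= k < hi) = hi - lo.
Proof.
move=> le_n; rewrite -[in RHS](minn_idPr le_n); move: n {le_n}.
elim=> [|n IH]; first by rewrite big_ord0 min0n.
by rewrite big_ord_recr /= IH; lia.
Qed.

(** One term for each branch of [blockswap]. By truncation [a + s + (b - a)] is the larger of
    [a + s] and [b + s]. *)
Lemma rank_blockperm n a s t p b : a + s + t <= n -> p <= n ->
  rank (blockperm n a s t) p b =
    (minn p a - b) + (minn p (a + s) - maxn a (b - t))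
    + (minn p (a + s + t) - (a + s + (b - a))) + (p - maxn b (a + s + t)).
Proof.
move=> le_n le_pn.
rewrite -[minn p a - b](@count_interval n) ?geq_min ?le_pn //.
rewrite -[minn p (a + s) - _](@count_interval n) ?geq_min ?le_pn //.
rewrite -[minn p (a + s + t) - _](@count_interval n) ?geq_min ?le_pn //.
rewrite -[p - _](@count_interval n) // /rank -!big_split /=.
apply: eq_bigr => k _; rewrite blockpermE // /blockswap !leq_min !geq_max.
move: (nat_of_ord k) => i.
case: (ltnP i a) => [ia|ai]; last case: (ltnP i (a + s)) => [ias|asi];
  last case: (ltnP i (a + s + t)) => [iast|asti]; by lia.
Qed.

Lemma rank_le_blockperm n a s t a' s' t' : 0 < s -> 0 < t ->
  a + s + t <= n -> a' + s' + t' <= n ->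
  (s <= rank (blockperm n a' s' t') (a + s) (a + t)) =
  [&& a' <= a, s <= s', t <= t' & a + s + t <= a' + s' + t'].
Proof.
move=> s_gt0 t_gt0 le_n le_n'; rewrite rank_blockperm //; last by lia.
clear n le_n le_n'.
(* All counted positions precede the blocks of the second exchange, so the rank is the truncated
   [s - t], less than [s]. *)
case: (leqP (a + s) a') => h1.
  by rewrite [a' <= a]leqNgt; lia.
case: (leqP (a + s) (a' + s')) => h2; case: (leqP (a + s) (a' + s' + t')) => h3;
  case: (leqP a' (a + t - t')) => h4;
  case: (leqP (a + t) (a' + s' + t')) => h5; lia.
Qed.

(** * Bigrassmannian permutations and their Bruhat order *)

Lemma not_descent n (w : 'S_n) (i j : 'I_n) :
  j = i.+1 :> nat -> (i \notin descents w) = (w i < w j).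
Proof.
move=> ji; rewrite inE; apply/idP/idP => [|wij].
  rewrite negb_exists => /forallP/(_ j); rewrite ji eqxx /= -leqNgt leq_eqVlt.
  case/predU1P => // /val_inj/perm_inj ij.
  by move: ji; rewrite ij; lia.
apply/negP => /existsP[k /andP[/eqP ki]].
suff -> : k = j by lia.
by apply/val_inj; rewrite /= ki ji.
Qed.

(** The descent is at the last position of the first block. Successors keep both blocks nonempty. *)
Lemma descents_blockperm n a s t (lt_n : a + s.+1 + t.+1 <= n)
    (lt_as : a + s < n) :
  descents (blockperm n a s.+1 t.+1) = [set Ordinal lt_as].
Proof.
apply/setP => i; rewrite inE [RHS]inE -val_eqE /=.
have [lt_in|le_ni] := ltnP i.+1 n.
  have := @not_descent n (blockperm n a s.+1 t.+1) i (Ordinal lt_in) erefl.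
  rewrite inE !blockpermE //= => /(congr1 negb); rewrite negbK => ->.
  by rewrite /blockswap; do !case: ifP; lia.
have -> : (i == a + s :> nat) = false by lia.
by apply/negbTE/existsP => -[j /andP[/eqP ji _]]; have := ltn_ord j; lia.
Qed.

Lemma bigrass_blockperm n a s t :
  a + s.+1 + t.+1 <= n -> blockperm n a s.+1 t.+1 \in bigrass n.
Proof.
move=> le_n; rewrite inE /bigrassmannian blockpermV //.
have le_n' : a + t.+1 + s.+1 <= n by lia.
have lt_s : a + s < n by lia.
have lt_t : a + t < n by lia.
by rewrite (descents_blockperm le_n lt_s) (descents_blockperm le_n' lt_t) !cards1.
Qed.

Lemma two_runs_bigrass n (w : 'S_n) : #|descents w| == 1%N ->
  exists d d' : 'I_n, [/\ d' = d.+1 :> nat, w d' < w d & two_runs w d'].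
Proof.
case/cards1P => d dE; have : d \in descents w by rewrite dE set11.
rewrite inE => /existsP[d' /andP[/eqP d'E wd]].
exists d, d'; split=> //; apply: two_runs_adjacent => i j ji ne.
by rewrite -not_descent // dE inE -val_eqE /=; lia.
Qed.

(** The descents of [w] and of its inverse supply the [p] and [b] of [two_runs_blockperm]. With an
    empty block the exchange would be the identity, which has no descent. *)
Lemma bigrassP n (w : 'S_n) : w \in bigrass n ->
  exists a s t, a + s.+1 + t.+1 <= n /\ w = blockperm n a s.+1 t.+1.
Proof.
rewrite inE => /andP[/two_runs_bigrass[d [p [pd wd runs]]]].
case/two_runs_bigrass => [d' [b [bd wd' runsV]]].
have := two_runs_blockperm (ltnW (ltn_ord p)) (ltnW (ltn_ord b)) runs runsV.
set s := rank w p b => -[sp psb bsn wE].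
have le_n : p - s + s + (b - (p - s)) <= n by lia.
have [s_gt0 t_gt0] : 0 < s /\ 0 < b - (p - s).
  move: wd; rewrite wE !blockpermE // /blockswap.
  by do !case: ifP; lia.
by exists (p - s), s.-1, (b - (p - s)).-1; rewrite !prednK.
Qed.

(* A permutation of largest weight among those below w of rank at least s has
   no reduction keeping that rank, so it is the block transposition. *)
Lemma bruhat_blockperm n a s t (w : 'S_n) : 0 < s -> 0 < t -> a + s + t <= n ->
  bruhat_le (blockperm n a s t) w = (s <= rank w (a + s) (a + t)).
Proof.
move=> s_gt0 t_gt0 le_n; set p := a + s; set b := a + t.
apply/idP/idP => [/(rank_bruhat p b)|ranks].
  by apply: leq_trans; rewrite rank_le_blockperm //; lia.
pose P (v : 'S_n) := bruhat_le v w && (s <= rank v p b).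
have Pw : P w by rewrite /P ranks andbT; apply: connect0.
case: (arg_maxnP (@weight n) Pw) => v /andP[vw sv] vmax.
have stuck v' : reduction v v' -> rank v' p b < s.
  move=> vv'; rewrite ltnNge; apply/negP => sv'.
  have Pv' : P v' by rewrite /P sv' andbT; apply: connect_trans vw (connect1 vv').
  by have := vmax _ Pv'; rewrite /= leqNgt weight_reduction.
have stuck_ij (i j : 'I_n) : i < j -> v j < v i -> rank (tperm i j * v)%g p b < s.
  by move=> ij vij; apply: stuck; apply/reductionP; exists i, j.
have le_pn : p <= n by lia.
have le_bn : b <= n by lia.
have ord_lt (i j : 'I_n) : i < j -> i != j by rewrite neq_ltn => ->.
(* Swapping adjacent positions on the same side of [p] preserves the rank, so a descent there would
   contradict [stuck]. *)
have runs : two_runs v p.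
  apply: two_runs_adjacent => i j ji ip; have ij : i < j by lia.
  case: ltngtP => // [vji|/val_inj/perm_inj eij]; last first.
    by have := ord_lt _ _ ij; rewrite eij eqxx.
  have := stuck_ij i j ij vji; have := rank_swap v p b (ord_lt _ _ ij).
  by lia.
(* Dually, swapping consecutive values on the same side of [b] preserves the rank. *)
have runsV : two_runs v^-1%g b.
  apply: two_runs_adjacent => x y yx xb; set j := v^-1%g x; set i := v^-1%g y.
  have xE : v j = x by rewrite permKV.
  have yE : v i = y by rewrite permKV.
  case: ltngtP => // [ij|/val_inj eij]; last by move: yx; rewrite -xE -yE eij; lia.
  have := stuck_ij i j ij; have := rank_swap v p b (ord_lt _ _ ij).
  by rewrite xE yE; lia.
have [vp vb bv vE] := two_runs_blockperm le_pn le_bn runs runsV.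
have [vs|vs] := leqP (rank v p b) s.
  have rE : rank v p b = s by lia.
  move: vE; rewrite rE.
  have -> : p - s = a by lia.
  have -> : b - a = t by lia.
  by move <-.
(* If the rank exceeded [s], undoing the descent from [p - 1] to [p] would lower it by at most one
   and leave it at least [s]. *)
set r := rank v p b in vp vb bv vE vs.
have lt_p : p < n by lia.
have lt_p1 : p.-1 < n by lia.
have lt_pp : Ordinal lt_p1 < Ordinal lt_p by rewrite /=; lia.
have le_n' : p - r + r + (b - (p - r)) <= n by lia.
have desc : v (Ordinal lt_p) < v (Ordinal lt_p1).
  by rewrite vE !blockpermE // /blockswap /=; do !case: ifP; lia.
have := stuck_ij _ _ lt_pp desc.
have : reduction v (tperm (Ordinal lt_p1) (Ordinal lt_p) * v)%g.
  by apply/reductionP; exists (Ordinal lt_p1), (Ordinal lt_p).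
by move/(rank_reduction p b); rewrite -/r; lia.
Qed.

Lemma bruhat_le_blockperm n a s t a' s' t' : 0 < s -> 0 < t ->
  a + s + t <= n -> a' + s' + t' <= n ->
  bruhat_le (blockperm n a s t) (blockperm n a' s' t') =
  [&& a' <= a, s <= s', t <= t' & a + s + t <= a' + s' + t'].
Proof. by move=> *; rewrite bruhat_blockperm // rank_le_blockperm. Qed.

(** Equal permutations lie below each other, and the four inequalities in both directions force
    equal parameters. *)
Lemma blockperm_inj n a s t a' s' t' :
  a + s.+1 + t.+1 <= n -> a' + s'.+1 + t'.+1 <= n ->
  blockperm n a s.+1 t.+1 = blockperm n a' s'.+1 t'.+1 ->
  [/\ a = a', s = s' & t = t'].
Proof.
move=> le_n le_n' eq_w.
have := bruhat_le_blockperm (ltn0Sn s) (ltn0Sn t) le_n le_n'.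
have := bruhat_le_blockperm (ltn0Sn s') (ltn0Sn t') le_n' le_n.
by rewrite eq_w /bruhat_le connect0 => /esym h1 /esym h2; split; lia.
Qed.

(** * Sums over block lengths in closed form *)

Lemma sum_bigrass n (F : 'S_n -> nat) :
  \sum_(w in bigrass n) F w =
  \sum_(i < n) \sum_(j < n) \sum_(a < n | a + i.+1 + j.+1 <= n)
    F (blockperm n a i.+1 j.+1).
Proof.
rewrite pair_big pair_big_dep /=.
pose f (x : 'I_n * 'I_n * 'I_n) := blockperm n x.2 x.1.1.+1 x.1.2.+1.
pose D := [set x : 'I_n * 'I_n * 'I_n | x.2 + x.1.1.+1 + x.1.2.+1 <= n].
have -> : bigrass n = f @: D.
  apply/setP => w; apply/idP/imsetP => [/bigrassP[a [s [t [le_n ->]]]]|[x]].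
    have lt_a : a < n by lia.
    have lt_s : s < n by lia.
    have lt_t : t < n by lia.
    by exists (Ordinal lt_s, Ordinal lt_t, Ordinal lt_a); rewrite ?inE.
  by rewrite inE => le_n ->; apply: bigrass_blockperm.
rewrite big_imset /=; first by apply: eq_bigl => x; rewrite inE.
move=> [[i j] a] [[i' j'] a']; rewrite !inE /f /= => le_n le_n'.
by case/(blockperm_inj le_n le_n') => /val_inj -> /val_inj -> /val_inj ->.
Qed.

(** The factor [n - (i + j).+1] is the number of starts for blocks of lengths [i.+1] and [j.+1],
    zero if they do not fit. The separate range [M] stays fixed while [n] varies in the
    recursion. *)
Definition simplex_sum (h : nat -> nat -> nat) (M n : nat) : nat :=
  \sum_(i < M) \sum_(j < M) (n - (i + j).+1) * h i j.

Lemma sum_narrow n m (g : nat -> nat) : m <= n ->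
  \sum_(i < n) (i < m) * g i = \sum_(i < m) g i.
Proof.
move=> le_mn; rewrite (big_ord_widen n g le_mn) [RHS]big_mkcond.
by apply: eq_bigr => i _; case: ltnP; rewrite ?mul1n ?mul0n.
Qed.

(** The second difference in [n] of the truncated [n - (i + j).+1] is the indicator of [i + j = n];
    [n < M] keeps that antidiagonal within range. *)
Lemma simplex_sum_diff h M n : n < M ->
  simplex_sum h M n.+2 + simplex_sum h M n =
  2 * simplex_sum h M n.+1 + \sum_(i < n.+1) h i (n - i).
Proof.
move=> lt_nM; rewrite -(sum_narrow (fun i => h i (n - i)) lt_nM).
rewrite /simplex_sum big_distrr -!big_split /=; apply: eq_bigr => i _.
have -> : (i < n.+1) * h i (n - i) = \sum_(j < M) (i + j == n) * h i j.
  have [le_in|lt_ni] := ltnP i n.+1.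
    have lt_M : n - i < M by lia.
    rewrite (bigD1 (Ordinal lt_M)) //= subnKC // eqxx big1 ?addn0 // => j.
    by rewrite -val_eqE /= => ne; have -> : i + j == n = false by lia.
  rewrite big1 // => j _; have -> : i + j == n = false by lia.
  by [].
rewrite big_distrr -!big_split /=; apply: eq_bigr => j _.
rewrite mulnA -!mulnDl; congr (_ * _).
by lia.
Qed.

Lemma simplex_sum0 h M : simplex_sum h M 0 = 0.
Proof. by rewrite /simplex_sum big1 // => i _; rewrite big1. Qed.

Lemma simplex_sum1 h M : simplex_sum h M 1 = 0.
Proof.
by rewrite /simplex_sum big1 // => i _; rewrite big1 // => j _; rewrite subSS.
Qed.

Lemma simplex_sum_cst M n : n <= M ->
  6 * simplex_sum (fun _ _ => 1) M n + n = n ^ 3.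
Proof.
(* The recursion has order two, so the induction carries two consecutive values. *)
suff H k : k < M -> 6 * simplex_sum (fun _ _ => 1) M k + k = k ^ 3 /\
    6 * simplex_sum (fun _ _ => 1) M k.+1 + k.+1 = k.+1 ^ 3.
  by case: n => [|n] le_n; [rewrite simplex_sum0 | case: (H n le_n)].
elim: k => [|k IH] lt_k; first by rewrite simplex_sum0 simplex_sum1.
have [IH1 IH2] := IH (ltnW lt_k); split=> //.
have := simplex_sum_diff (fun _ _ => 1) (ltnW lt_k).
rewrite sum_nat_const card_ord muln1.
by move: IH1 IH2; rewrite !expnS expn0; lia.
Qed.

(** Splits the summand as [i.+1 * m.+1 - i * i.+1]. The limit [n] is freed from [m] for the
    induction; at [n = m.+1] the sum is the binomial of [m + 3] over 3. *)
Lemma sum_diagonal m n : n <= m.+1 ->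
  6 * (\sum_(i < n) i.+1 * (m - i).+1) + 2 * (n.-1 * n * n.+1) =
  3 * (n * n.+1 * m.+1).
Proof.
elim: n => [|n IH] le_n; first by rewrite big_ord0.
rewrite big_ord_recr /=; move: (IH (ltnW le_n)).
have [d ->] : exists d, m = n + d by exists (m - n); lia.
rewrite addKn; case: n {IH le_n} => [|n]; first by rewrite big_ord0; lia.
by rewrite /=; nia.
Qed.

(** Solves the same recursion with antidiagonal sums [k.+2] times the binomial of [k + 3] over 3.
    The closed form is b_n b_(n+2) / 5, cleared of denominators and subtraction. *)
Lemma simplex_sum_prod M n : n <= M ->
  180 * simplex_sum (fun i j => i.+1 * j.+1 * (i + j).+2) M n
    + n * n.+1 * n.+2 * n.+3 = n ^ 3 * n.+1 * n.+2 * n.+3.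
Proof.
set h := fun i j : nat => _; pose T := simplex_sum h M.
suff H k : k < M ->
    180 * T k + k * k.+1 * k.+2 * k.+3 = k ^ 3 * k.+1 * k.+2 * k.+3 /\
    180 * T k.+1 + k.+1 * k.+2 * k.+3 * k.+4 = k.+1 ^ 3 * k.+2 * k.+3 * k.+4.
  by case: n => [|n] le_n; [rewrite simplex_sum0 | case: (H n le_n)].
elim: k => [|k IH] lt_k; first by rewrite /T simplex_sum0 simplex_sum1.
have [IH1 IH2] := IH (ltnW lt_k); split=> //.
have := simplex_sum_diff h (ltnW lt_k).
have -> : \sum_(i < k.+1) h i (k - i) = (\sum_(i < k.+1) i.+1 * (k - i).+1) * k.+2.
  rewrite big_distrl; apply: eq_bigr => i _ /=.
  by rewrite /h subnKC // -ltnS.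
have := sum_diagonal (leqnn k.+1); set S := \sum_(i < _) _.
move: IH1 IH2; rewrite -/(T _) -/(T k.+1) -/(T k) /= !expnS expn0 !muln1.
move: (T k) (T k.+1) (T k.+2) S => t t1 t2 S IH1 IH2 SE TE.
have {}SE : 6 * S = k.+1 * k.+2 * k.+3 by nia.
nia.
Qed.

Lemma sum_rectangle I J :
  2 * (\sum_(i < I) \sum_(j < J) (i + j).+1) = I * J * (I + J).
Proof.
have row i : 2 * (\sum_(j < J) (i + j).+1) = J * (2 * i + J.+1).
  elim: J => [|J IH]; first by rewrite big_ord0.
  by rewrite big_ord_recr /= mulnDr IH; ring.
elim: I => [|I IH]; first by rewrite big_ord0.
by rewrite big_ord_recr /= mulnDr IH row; ring.
Qed.

(** * Counting bigrassmannian permutations and comparable pairs *)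

Lemma card_bigrass n : 6 * nb_bigrass n + n = n ^ 3.
Proof.
rewrite -(simplex_sum_cst (leqnn n)) /nb_bigrass -sum1_card sum_bigrass.
congr (6 * _ + n); apply: eq_bigr => i _; apply: eq_bigr => j _.
rewrite big_mkcond muln1 -[RHS]subn0 -(@count_interval n) ?leq_subr //.
by apply: eq_bigr => a _ /=; case: ifP; lia.
Qed.

Definition nb_bruhat_pairs n : nat :=
  \sum_(w' in bigrass n) \sum_(w in bigrass n) bruhat_le w w'.

(** Blocks of lengths [i.+1 <= s.+1] and [j.+1 <= t.+1] may start anywhere from [a] to
    [a + (s - i) + (t - j)]. Reversing [i] and [j] yields the sum of [sum_rectangle]. *)
Lemma card_lower_bigrass n a s t : a + s.+1 + t.+1 <= n ->
  2 * (\sum_(w in bigrass n) bruhat_le w (blockperm n a s.+1 t.+1)) =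
  s.+1 * t.+1 * (s + t).+2.
Proof.
move=> le_n; rewrite sum_bigrass -addSn -addnS -sum_rectangle; congr (2 * _).
transitivity (\sum_(i < n) (i < s.+1) *
    \sum_(j < n) (j < t.+1) * ((s - i) + (t - j)).+1).
  apply: eq_bigr => i _; rewrite big_distrr; apply: eq_bigr => j _ /=.
  have [is_|si] := ltnP i s.+1; last first.
    by rewrite big1 // => b b_n; rewrite bruhat_le_blockperm //; lia.
  have [jt|tj] := ltnP j t.+1; last first.
    by rewrite big1 // => b b_n; rewrite bruhat_le_blockperm //; lia.
  (* The count is rewritten as the length of the interval of admissible starts. *)
  have -> : true * (true * ((s - i) + (t - j)).+1) =
    a + ((s - i) + (t - j)).+1 - a by lia.
  rewrite -(@count_interval n) ; last by lia.
  rewrite big_mkcond; apply: eq_bigr => b _.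
  case: ifP => b_n; last by lia.
  by rewrite bruhat_le_blockperm //; lia.
rewrite (sum_narrow (fun i => \sum_(j < n) (j < t.+1) * ((s - i) + (t - j)).+1));
  last by lia.
rewrite (reindex_inj rev_ord_inj); apply: eq_bigr => i _ /=.
rewrite (sum_narrow (fun j => ((s - (s.+1 - i.+1)) + (t - j)).+1)); last by lia.
rewrite (reindex_inj rev_ord_inj); apply: eq_bigr => j _ /=.
by have := ltn_ord i; have := ltn_ord j; lia.
Qed.

Lemma nb_bruhat_pairsE n :
  10 * nb_bruhat_pairs n = nb_bigrass n * nb_bigrass n.+2.
Proof.
have pairsE : 2 * nb_bruhat_pairs n =
    simplex_sum (fun i j => i.+1 * j.+1 * (i + j).+2) n n.
  rewrite /nb_bruhat_pairs sum_bigrass big_distrr; apply: eq_bigr => i _ /=.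
  rewrite big_distrr; apply: eq_bigr => j _ /=.
  rewrite big_distrr /=; under eq_bigr => a le_n do rewrite card_lower_bigrass //.
  rewrite -[n - _]subn0 -(@count_interval n) ?leq_subr // big_distrl big_mkcond.
  apply: eq_bigr => a _ /=.
  have -> : (a < n - (i + j).+1) = (a + i.+1 + j.+1 <= n) by lia.
  by case: ifP; rewrite ?mul1n.
have := simplex_sum_prod (leqnn n); rewrite -pairsE.
have := card_bigrass n; have := card_bigrass n.+2.
move: (nb_bigrass n) (nb_bigrass n.+2) (nb_bruhat_pairs n) => b b2 N.
rewrite !expnS expn0 !muln1 => E2 E1 E3.
have {}E2 : 6 * b2 = n.+1 * n.+2 * n.+3 by nia.
(* The factor 36 clears the denominators of both closed forms. *)
have : 360 * N = 6 * b * (6 * b2) by nia.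
by nia.
Qed.

(** * From counts to probabilities *)

Local Open Scope ring_scope.
Import GRing.Theory Num.Theory.

Lemma prob_pairE (T : finType) (A : {set T}) (E : rel T) :
  prob_pair A E =
  (\sum_(x in A) \sum_(y in A) E x y)%N%:R / #|A|%:R ^+ 2.
Proof.
rewrite /prob_pair natr_sum mulr_suml [RHS]big_mkcond; apply: eq_bigr => x _.
rewrite /uniform; case: (x \in A); last by rewrite big1 // => y _; rewrite mul0r.
rewrite natr_sum mulr_suml [RHS]big_mkcond [LHS]big_mkcond; apply: eq_bigr => y _.
by case: (E x y); case: (y \in A); rewrite ?mul0r ?mulr0 ?mul1r // -expr2 exprVn.
Qed.

Lemma bruhat_le_anti_bigrass n (w w' : 'S_n) :
  w \in bigrass n -> w' \in bigrass n ->
  bruhat_le w w' && bruhat_le w' w = (w == w').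
Proof.
move=> /bigrassP[a [s [t [le_n ->]]]] /bigrassP[a' [s' [t' [le_n' ->]]]].
apply/idP/eqP => [|->]; last by rewrite andbb; apply: connect0.
rewrite !bruhat_le_blockperm // => h.
by have [-> -> ->] : [/\ a = a', s = s' & t = t'] by split; lia.
Qed.

(** Inclusion-exclusion: pairs related in both directions are diagonal by antisymmetry, and each
    direction contributes the same number. *)
Lemma nb_comparable_pairs n :
  (\sum_(w in bigrass n) \sum_(w' in bigrass n) bruhat_comparable w w' +
    nb_bigrass n = 2 * nb_bruhat_pairs n)%N.
Proof.
have diagE : nb_bigrass n =
    (\sum_(w in bigrass n) \sum_(w' in bigrass n) (w == w'))%N.
  rewrite /nb_bigrass -sum1_card; apply: eq_bigr => w w_in.
  rewrite (bigD1 w) //= eqxx big1 // => w' /andP[_].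
  by rewrite eq_sym => /negbTE ->.
rewrite diagE mul2n -addnn {1}/nb_bruhat_pairs.
rewrite [X in _ = (X + _)%N]exchange_big -!big_split /=.
apply: eq_bigr => w w_in; rewrite -!big_split; apply: eq_bigr => w' w'_in /=.
rewrite -bruhat_le_anti_bigrass // /bruhat_comparable.
by case: (bruhat_le w w'); case: (bruhat_le w' w).
Qed.

Theorem theorem1p5 (n : nat) (hn : (2 <= n)%N) :
  p_comparable n = ((nb_bigrass n.+2)%:R - 5) / (5 * (nb_bigrass n)%:R) /\
  p_le n = (nb_bigrass n.+2)%:R / (10 * (nb_bigrass n)%:R).
Proof.
(* Here [2 <= n] enters: it gives [n < n ^ 3]. *)
have b_neq0 : (nb_bigrass n)%:R != 0 :> rat.
  rewrite pnatr_eq0; apply/eqP => b0; have := card_bigrass n.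
  by rewrite b0 !expnS expn0; nia.
have pairsE : 10 * (nb_bruhat_pairs n)%:R =
    (nb_bigrass n)%:R * (nb_bigrass n.+2)%:R :> rat.
  by rewrite -!natrM nb_bruhat_pairsE.
split.
  rewrite /p_comparable prob_pairE -/(nb_bigrass n).
  have := congr1 (fun m => m%:R : rat) (nb_comparable_pairs n).
  rewrite natrD natrM => cmpE.
  apply: (mulIf b_neq0); apply: (mulIf b_neq0).
  move: cmpE pairsE; set c := (\sum_(_ in _) _)%N%:R => cmpE pairsE.
  have -> : c = 2 * (nb_bruhat_pairs n)%:R - (nb_bigrass n)%:R.
    by rewrite -cmpE addrK.
  have -> : (nb_bruhat_pairs n)%:R =
      (nb_bigrass n)%:R * (nb_bigrass n.+2)%:R / 10 :> rat.
    by rewrite -pairsE mulrC mulKf.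
  by field.
(* [nb_bruhat_pairs] has the larger element in the outer sum, hence the exchange. *)
rewrite /p_le prob_pairE -/(nb_bigrass n) exchange_big -/(nb_bruhat_pairs n).
have -> : (nb_bruhat_pairs n)%:R =
    (nb_bigrass n)%:R * (nb_bigrass n.+2)%:R / 10 :> rat.
  by rewrite -pairsE mulrC mulKf.
by field.
Qed.
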